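(* Let $\mathsf{L_1}, \mathsf{L_2} \in \{\mathsf{S4}, \mathsf{D4}, \mathsf{D}, \mathsf{T}\}$. Then $$\mathsf{L_1} \times_n \mathsf{L_2} = \mathsf{L_1} \otimes \mathsf{L_2}.$$
   Context: Formulas: $\phi ::= p \mid \bot \mid \phi\to\phi \mid \Box_i\phi$, with $p$ a propositional letter (from a fixed countably infinite set); other Boolean connectives are abbreviations and $\Diamond_i = \lnot\Box_i\lnot$. There is one modality $\Box$ in the unimodal language and two modalities $\Box_1,\Box_2$ in the bimodal language. A (normal) logic is a set of formulas containing all classical tautologies and the axioms $\Box_i(p\to q)\to(\Box_i p\to\Box_i q)$, closed under substitution, modus ponens and generalization $A/\Box_i A$ (for each $i$). $\mathsf{K}_n$ is the minimal normal logic with $n$ modalities, $\mathsf{K}=\mathsf{K}_1$, and $\mathsf{L}+\Gamma$ is the minimal logic containing $\mathsf{L}\cup\Gamma$. $\mathsf{D}=\mathsf{K}+(\Box p\to\Diamond p)$; $\mathsf{T}=\mathsf{K}+(\Box p\to p)$; $\mathsf{D4}=\mathsf{D}+(\Box p\to\Box\Box p)$; $\mathsf{S4}=\mathsf{T}+(\Box p\to\Box\Box p)$. Fusion: for unimodal logics $\mathsf{L_1},\mathsf{L_2}$, $\mathsf{L_1}\otimes\mathsf{L_2}=\mathsf{K}_2+\mathsf{L_1}_{(\Box\to\Box_1)}+\mathsf{L_2}_{(\Box\to\Box_2)}$, where $\mathsf{L}_{i(\Box\to\Box_i)}$ is the set of formulas of $\mathsf{L}_i$ with every $\Box$ replaced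 by $\Box_i$. A (monotone) neighborhood frame, or n-frame, is a pair $\mathfrak{X}=(X,\tau)$ with $X\neq\varnothing$ and $\tau:X\to 2^{2^X}$ such that $\tau(x)$ is a filter on $X$ for every $x$ (nonempty family closed under supersets and finite intersections; the improper filter is allowed). An n-2-frame is $(X,\tau_1,\tau_2)$ with both $\tau_1(x),\tau_2(x)$ filters on $X$ for every $x$. A model $M$ is a frame with a valuation of propositional letters as subsets of $X$; truth is as usual for Boolean connectives, and $M,x\models\Box_i\psi$ iff there is $V\in\tau_i(x)$ such that $M,y\models\psi$ for all $y\in V$. A formula is valid in a frame if it is true at all points of all models based on it. $\mathfrak{X}\models L$ means all formulas of $L$ are valid in $\mathfrak{X}$. For a class $\mathcal{C}$ of frames, $\mathrm{Log}(\mathcal{C})$ is the set of formulas valid in all frames of $\mathcal{C}$. $nV(L)$ is the class of all n-frames $\mathfrak{X}$ with $\mathfrak{X}\models L$. Product of n-frames $\mathfrak{X}_1=(X_1,\tau_1)$, $\mathfrak{X}_2=(X_2,\tau_2)$: the n-2-frame $\mathfrak{X}_1\times\mathfrak{X}_2=(X_1\times X_2,\tau_1',\tau_2')$ with $\tau_1'(x_1,x_2)=\{U\subseteq X_1\times X_2 \mid \exists V\in\tau_1(x_1)\ V\times\{x_2\}\subseteq U\}$ and $\tau_2'(x_1,x_2)=\{U\subseteq X_1\times X_2 \mid \exists V\in\tau_2(x_2)\ \{x_1\}\times V\subseteq U\}$. n-product of unimodal logics: $\mathsf{L_1}\times_n\mathsf{L_2}=\mathrm{Log}(\{\mathfrak{X}_1\times\mathfrak{X}_2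 \mid \mathfrak{X}_1\in nV(\mathsf{L_1}),\ \mathfrak{X}_2\in nV(\mathsf{L_2})\})$. *)

(* Defs.v *)
From mathcomp Require Import all_boot.
From mathcomp Require Import boolp classical_sets filter.

Set Implicit Arguments.
Unset Strict Implicit.
Unset Printing Implicit Defensive.

Local Open Scope classical_set_scope.

Inductive form (n : nat) : Type :=
| Var of nat
| Bot
| Imp of form n & form n
| Box of 'I_n & form n.

Arguments Var {n} _.
Arguments Bot {n}.

Definition Neg (n : nat) (A : form n) : form n := Imp A Bot.
Definition Dia (n : nat) (i : 'I_n) (A : form n) : form n := Neg (Box i (Neg A)).

Fixpoint subst (n : nat) (s : nat -> form n) (A : form n) : form n :=
  match A with
  | Var p => s p
  | Bot => Bot
  | Imp B C => Imp (subst s B) (subst s C)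
  | Box i B => Box i (subst s B)
  end.

(* Boxed formulas count as propositional atoms. *)
Definition tautology (n : nat) (A : form n) : Prop :=
  forall v : form n -> bool,
    v Bot = false ->
    (forall B C, v (Imp B C) = (v B ==> v C)) ->
    v A.

Definition axiomK (n : nat) (i : 'I_n) : form n :=
  Imp (Box i (Imp (Var 0) (Var 1))) (Imp (Box i (Var 0)) (Box i (Var 1))).

Record normal_logic (n : nat) (L : set (form n)) : Prop := NormalLogic {
  normal_taut : forall A, tautology A -> L A;
  normal_K : forall i, L (axiomK i);
  normal_subst : forall s A, L A -> L (subst s A);
  normal_mp : forall A B, L (Imp A B) -> L A -> L B;
  normal_gen : forall i A, L A -> L (Box i A)
}.

Definition logicK (n : nat) : set (form n) := smallest (@normal_logic n) set0.

Arguments logicK n : clear implicits.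

(* L + Gamma *)
Definition logic_add (n : nat) (L Gamma : set (form n)) : set (form n) :=
  smallest (@normal_logic n) (L `|` Gamma).

Definition axiomD : form 1 := Imp (Box ord0 (Var 0)) (Dia ord0 (Var 0)).
Definition axiomT : form 1 := Imp (Box ord0 (Var 0)) (Var 0).
Definition axiom4 : form 1 :=
  Imp (Box ord0 (Var 0)) (Box ord0 (Box ord0 (Var 0))).

Definition logicD : set (form 1) := logic_add (logicK 1) [set axiomD].
Definition logicT : set (form 1) := logic_add (logicK 1) [set axiomT].
Definition logicD4 : set (form 1) := logic_add logicD [set axiom4].
Definition logicS4 : set (form 1) := logic_add logicT [set axiom4].

Fixpoint rebox (i : 'I_2) (A : form 1) : form 2 :=
  match A with
  | Var p => Var p
  | Bot => Bot
  | Imp B C => Imp (rebox i B) (rebox i C)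
  | Box _ B => Box i (rebox i B)
  end.

(* The modalities Box_1 and Box_2 have indices ord0 and ord_max in 'I_2. *)
Definition fusion (L1 L2 : set (form 1)) : set (form 2) :=
  logic_add (logic_add (logicK 2) (rebox ord0 @` L1)) (rebox ord_max @` L2).

(* Filter (unlike ProperFilter) allows the improper filter. *)
Record nframe (n : nat) : Type := NFrame {
  carrier :> Type;
  tau : 'I_n -> carrier -> set (set carrier);
  carrier_nonempty : [set: carrier] !=set0;
  tau_filter : forall i x, Filter (tau i x)
}.

Fixpoint truth (n : nat) (X : nframe n) (v : nat -> set X) (x : X)
    (A : form n) : Prop :=
  match A with
  | Var p => v p x
  | Bot => False
  | Imp B C => truth v x B -> truth v x C
  | Box i B => exists2 V, tau i x V & forall y, V y -> truth v y B
  end.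

Definition valid (n : nat) (X : nframe n) (A : form n) : Prop :=
  forall (v : nat -> set X) (x : X), truth v x A.

Definition Log (n : nat) (C : set (nframe n)) : set (form n) :=
  [set A | forall X, C X -> valid X A].

Definition nV (n : nat) (L : set (form n)) : set (nframe n) :=
  [set X | forall A, L A -> valid X A].

Definition prod_tau (X1 X2 : nframe 1) (i : 'I_2) (x : X1 * X2) :
    set (set (X1 * X2)) :=
  if i == ord0 then
    [set U | exists2 V, tau ord0 x.1 V & V `*` [set x.2] `<=` U]
  else
    [set U | exists2 V, tau ord0 x.2 V & [set x.1] `*` V `<=` U].

Lemma prod_nonempty (X1 X2 : nframe 1) : [set: X1 * X2] !=set0.
Proof.
have [x1 _] := carrier_nonempty X1; have [x2 _] := carrier_nonempty X2.
by exists (x1, x2).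
Qed.

Lemma prod_tau_filter (X1 X2 : nframe 1) (i : 'I_2) (x : X1 * X2) :
  Filter (prod_tau i x).
Proof.
have F1 := @tau_filter 1 X1 ord0 x.1; have F2 := @tau_filter 1 X2 ord0 x.2.
rewrite /prod_tau; case: ifP => _; split=> [|U W [V tV sV] [V' tV' sV']|U W sUW [V tV sV]].
- by exists setT => //; exact: filterT.
- exists (V `&` V'); first exact: filterI.
  by move=> [a b] [[/= Va V'a] eb]; split; [exact: sV | exact: sV'].
- by exists V => //; exact: subset_trans sUW.
- by exists setT => //; exact: filterT.
- exists (V `&` V'); first exact: filterI.
  by move=> [a b] [/= ea [Vb V'b]]; split; [exact: sV | exact: sV'].
- by exists V => //; exact: subset_trans sUW.
Qed.

Definition nprod (X1 X2 : nframe 1) : nframe 2 :=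
  NFrame (prod_nonempty X1 X2) (@prod_tau_filter X1 X2).

Definition nproduct (L1 L2 : set (form 1)) : set (form 2) :=
  Log [set X | exists X1 X2 : nframe 1, [/\ nV L1 X1, nV L2 X2 & X = nprod X1 X2]].

(* Main.v *)
(* Fusions are Kripke complete, by canonicity of (D), (T) and (4), so it is
   enough to pull a Kripke model on a frame (W, R_1, R_2) back to a product of
   neighborhood frames.  Points of each factor are finite sequences of letters
   of W carrying time stamps; a small neighborhood of such a sequence consists
   of its admissible extensions by letters with late time stamps.  A pair of
   sequences is sent to the world reached by executing all their letters in the
   order of time.  Late letters of one factor are executed after all letters of
   the other one, so moving in the i-th factor prolongs the run by R_i-steps
   only, and this map preserves and reflects truth. *)
Require Import Defs.
From mathcomp Require Import all_boot.
From mathcomp Require Import boolp classical_sets filter.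

Local Open Scope classical_set_scope.

(** * Soundness: the fusion is contained in the n-product *)

Lemma smallest_normal_logic (n : nat) (G : set (form n)) :
  normal_logic (smallest (@normal_logic n) G).
Proof.
split.
- by move=> A tA L [nL _]; exact: normal_taut nL A tA.
- by move=> i L [nL _]; exact: normal_K nL i.
- by move=> s A LA L nL; apply: (normal_subst nL.1); exact: LA.
- by move=> A B LAB LA L nL; apply: (normal_mp nL.1 (A := A));
    [exact: LAB | exact: LA].
- by move=> i A LA L nL; apply: (normal_gen nL.1); exact: LA.
Qed.

Lemma truth_subst (n : nat) (X : nframe n) (v : nat -> set X)
    (s : nat -> form n) (A : form n) (x : X) :
  truth v x (subst s A) <-> truth (fun p => [set y | truth v y (s p)]) x A.
Proof.
elim: A x => [p | | B IHB C IHC | i B IHB] x //=.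
- by split=> H /IHB/H/IHC.
- by split=> -[V tV VB]; exists V => // y /VB/IHB.
Qed.

Lemma valid_normal_logic (n : nat) (X : nframe n) : normal_logic [set A | valid X A].
Proof.
split.
- move=> A tA v x; apply/asboolP; apply: (tA (fun B => `[< truth v x B >])).
    by apply/asboolP.
  by move=> B C; apply/asboolP/implyP => H /asboolP/H/asboolP.
- move=> i v x /= [V tV VAB] [V' tV' V'A].
  have F := tau_filter i x.
  by exists (V `&` V'); [exact: filterI | move=> y [/VAB + /V'A]; apply].
- by move=> s A vA v x; apply/truth_subst; exact: vA.
- by move=> A B vAB vA v x; apply: vAB; exact: vA.
- move=> i A vA v x; have F := tau_filter i x.
  by exists setT; [exact: filterT | move=> y _; exact: vA].
Qed.

(** Basic neighborhoods for [ord0] stay in the row with second coordinate [x2], so this row behaves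
    as a copy of [X1]. *)
Lemma truth_rebox0 (X1 X2 : nframe 1) (v : nat -> set (nprod X1 X2))
    (A : form 1) (x1 : X1) (x2 : X2) :
  @truth 2 (nprod X1 X2) v (x1, x2) (rebox ord0 A) <->
  truth (fun p => [set y | v p (y, x2)]) x1 A.
Proof.
elim: A x1 => [p | | B IHB C IHC | i B IHB] x1 //=.
  by split=> H /IHB/H/IHC.
rewrite (ord1 i) /prod_tau /=; split.
- move=> [U [V tV VU] UB]; exists V => // y Vy.
  by apply/IHB/UB/VU; split.
- move=> [V tV VB]; exists (V `*` [set x2]); first by exists V.
  by move=> [y z] [/= Vy ->]; exact/IHB/VB.
Qed.

Lemma truth_rebox1 (X1 X2 : nframe 1) (v : nat -> set (nprod X1 X2))
    (A : form 1) (x1 : X1) (x2 : X2) :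
  @truth 2 (nprod X1 X2) v (x1, x2) (rebox ord_max A) <->
  truth (fun p => [set y | v p (x1, y)]) x2 A.
Proof.
elim: A x2 => [p | | B IHB C IHC | i B IHB] x2 //=.
  by split=> H /IHB/H/IHC.
rewrite (ord1 i) /prod_tau /=; split.
- move=> [U [V tV VU] UB]; exists V => // y Vy.
  by apply/IHB/UB/VU; split.
- move=> [V tV VB]; exists ([set x1] `*` V); first by exists V.
  by move=> [y z] [/= -> Vz]; exact/IHB/VB.
Qed.

Lemma fusion_sub_nproduct (L1 L2 : set (form 1)) :
  fusion L1 L2 `<=` nproduct L1 L2.
Proof.
move=> A fA _ [X1 [X2 [nX1 nX2 ->]]].
apply: fA; split; first exact: valid_normal_logic.
move=> B [fB | [C LC <-]]; last first.
  by move=> v [x1 x2]; apply/truth_rebox1; exact: nX2.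
apply: fB; split; first exact: valid_normal_logic.
move=> C [kC | [D LD <-]].
  by apply: kC; split; [exact: valid_normal_logic | exact: sub0set].
by move=> v [x1 x2]; apply/truth_rebox0; exact: nX1.
Qed.

Definition axiomTD (r : bool) : form 1 := if r then axiomT else axiomD.

(** Two switches treat the four logics uniformly: [r] chooses T over D, and [t] tells whether 4 is
    an axiom. *)
Lemma logic_cases {L : set (form 1)} :
  [set logicS4; logicD4; logicD; logicT] L ->
  exists r t : bool, [/\ L (axiomTD r), t -> L axiom4 &
    forall X : nframe 1, valid X (axiomTD r) -> (t -> valid X axiom4) -> nV L X].
Proof.
have sub1 (Q G : set (form 1)) : Q `|` G `<=` logic_add Q G.
  by move=> A QA M [_]; apply.
have nVadd (Q : set (form 1)) (A : form 1) X :
    nV Q X -> valid X A -> nV (logic_add Q [set A]) X.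
  move=> QX XA B; apply; split; first exact: valid_normal_logic.
  by move=> C [/QX | ->].
have nVK X : nV (logicK 1) X.
  by move=> B; apply; split; [exact: valid_normal_logic | exact: sub0set].
move=> [[[->|->]|->]|->].
- exists true, true; split=> [|_|X XT /(_ isT) X4].
  + by apply: (sub1); left; apply: (sub1); right.
  + by apply: (sub1); right.
  + by apply: (nVadd) => //; apply: nVadd.
- exists false, true; split=> [|_|X XT /(_ isT) X4].
  + by apply: (sub1); left; apply: (sub1); right.
  + by apply: (sub1); right.
  + by apply: (nVadd) => //; apply: nVadd.
- exists false, false; split=> // [|X XT _]; last exact: nVadd.
  by apply: (sub1); right.
- exists true, false; split=> // [|X XT _]; last exact: nVadd.
  by apply: (sub1); right.
Qed.

(** * Kripke completeness *)

Fixpoint ktruth {n : nat} {W : Type} (R : 'I_n -> W -> W -> Prop)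
    (v : nat -> W -> Prop) (w : W) (A : form n) : Prop :=
  match A with
  | Var p => v p w
  | Bot => False
  | Imp B C => ktruth R v w B -> ktruth R v w C
  | Box i B => forall u, R i w u -> ktruth R v u B
  end.

(** The labels 0, 1 and [i.+2] keep the constructors apart; generic trees over [nat] are countable,
    which yields [code]. *)
Fixpoint code_tree {n : nat} (A : form n) : GenTree.tree nat :=
  match A with
  | Var p => GenTree.Leaf p
  | Bot => GenTree.Node 0 [::]
  | Imp B C => GenTree.Node 1 [:: code_tree B; code_tree C]
  | Box i B => GenTree.Node i.+2 [:: code_tree B]
  end.

Lemma code_tree_inj {n : nat} : injective (@code_tree n).
Proof.
elim=> [p | | B IHB C IHC | i B IHB] [q | | D E | j D] //=.
- by case=> ->.
- by case=> /IHB -> /IHC ->.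
- by case=> /val_inj -> /IHB ->.
Qed.

Definition code {n : nat} (A : form n) : nat := pickle (code_tree A).

Lemma code_inj {n : nat} : injective (@code n).
Proof. by move=> A B /(pcan_inj pickleK)/code_tree_inj. Qed.

Section Canonical.
Context {n : nat} (L : set (form n)) (nL : normal_logic L).

(** Closure under modus ponens but not under generalization, so that the deduction theorem holds
    when a formula is adjoined. *)
Definition theory (T : set (form n)) : Prop :=
  L `<=` T /\ forall A B, T (Imp A B) -> T A -> T B.

Definition complete_theory (T : set (form n)) : Prop :=
  [/\ theory T, ~ T Bot & forall A, T A \/ T (Neg A)].

Lemma theory_taut {T A} : theory T -> tautology A -> T A.
Proof. by move=> [LT _] tA; apply: LT; exact: normal_taut nL A tA. Qed.

Local Ltac taut :=
  let v := fresh "v" in let vI := fresh "vI" in let v0 := fresh "v0" in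
  move=> v v0 vI; rewrite /Neg ?vI ?v0;
  repeat (let b := fresh "b" in
          match goal with |- context [v ?A] => case: (v A) => //= end).

(** A theory containing [T] that is maximal among those omitting [B] decides every formula. *)
Lemma lindenbaum {T B} : theory T -> ~ T B ->
  exists2 M, complete_theory M & T `<=` M /\ ~ M B.
Proof.
move=> thT nTB.
(* The empty set is admitted because [Zorn_bigcup] allows empty chains. *)
pose P (X : set (form n)) := X `<=` set0 \/ [/\ theory X, T `<=` X & ~ X B].
have [F FP totF|M [PM maxM]] := @Zorn_bigcup _ P.
  have [[X [FX [A XA]]]|F0] := pselect (exists X, F X /\ X !=set0); last first.
    by left=> A [X FX XA]; apply: F0; exists X; split=> //; exists A.
  have good Y C : F Y -> Y C -> [/\ theory Y, T `<=` Y & ~ Y B].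
    by move=> /FP [Y0 YC|//]; case: (Y0 C YC).
  have [[LX mpX] TX nXB] := good _ _ FX XA.
  right; split.
  - split; first by move=> C /LX XC; exists X.
    move=> C D [Y FY YCD] [Z FZ ZC].
    have [[_ mpY] _ _] := good _ _ FY YCD.
    have [[_ mpZ] _ _] := good _ _ FZ ZC.
    have [YZ|ZY] := totF _ _ FY FZ.
      by exists Z => //; apply: (mpZ C) => //; exact: YZ.
    by exists Y => //; apply: (mpY C) => //; exact: ZY.
  - by move=> C /TX XC; exists X.
  - by move=> [Y FY YB]; have [_ _] := good _ _ FY YB.
have TBot : T (Imp Bot Bot) by apply: theory_taut thT _; taut.
have [thM TM nMB] : [/\ theory M, T `<=` M & ~ M B].
  (* The maximal element is not empty, since [T] contains a tautology and would be strictly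
     larger. *)
  case: PM => // M0; exfalso; apply: (maxM T).
    by split=> [A /M0 //|TM]; exact: M0 (TM _ TBot).
  by right; split.
have [LM mpM] := thM.
(* The formulas [C] with [Imp A C] in [M] form the theory generated by [M] and [A]. It properly
   extends [M], so by maximality it contains [B]. *)
have ext A : ~ M A -> M (Imp A B).
  move=> nMA; apply: contrapT => nMAB.
  apply: (maxM [set C | M (Imp A C)]).
    split=> [C MC|sub].
      by apply: (mpM _ _ _ MC); apply: theory_taut thM _; taut.
    by apply: nMA; apply: sub; apply: theory_taut thM _; taut.
  right; split=> //.
  - split=> [C LC|C D /= MCD MC].
      by apply: (mpM _ _ _ (LM _ LC)); apply: theory_taut thM _; taut.
    apply: (mpM _ _ _ MC); apply: (mpM _ _ _ MCD); apply: theory_taut thM _; taut.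
  - by move=> C /TM MC; apply: (mpM _ _ _ MC); apply: theory_taut thM _; taut.
exists M => //; split=> //.
  move=> MBot; apply: nMB; apply: (mpM _ _ _ MBot).
  by apply: theory_taut thM _; taut.
move=> A; have [|nMA] := pselect (M A); first by left.
(* If [A] and [Neg A] were both missing, both would imply [B] in [M], and [B] would follow by
   cases. *)
right; apply: contrapT => /ext MNB; apply: nMB.
apply: (mpM _ _ _ (ext A nMA)); apply: (mpM _ _ _ MNB).
by apply: theory_taut thM _; taut.
Qed.

(* [form n] lives in a universe too large for the carrier of an [nframe], hence
   worlds are sets of codes. *)
Definition world := {f : nat -> bool | complete_theory [set A | f (code A)]}.

Definition truths (w : world) : set (form n) := [set A | sval w (code A)].

Lemma world_of {T} : complete_theory T -> exists w, truths w = T.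
Proof.
move=> cT; pose f k := `[< exists2 A, T A & code A = k >].
have fE : [set A | f (code A)] = T.
  apply/seteqP; split=> A; first by move=> /asboolP[B TB /code_inj <-].
  by move=> TA; apply/asboolP; exists A.
have cf : complete_theory [set A | f (code A)] by rewrite fE.
by exists (exist _ f cf).
Qed.

Definition canonical_rel (i : 'I_n) (w u : world) : Prop :=
  forall A, truths w (Box i A) -> truths u A.

Definition canonical_val (p : nat) (w : world) : Prop := truths w (Var p).

Lemma world_theory (w : world) : theory (truths w).
Proof. by have [] := svalP w. Qed.

Lemma world_mp (w : world) A B : truths w (Imp A B) -> truths w A -> truths w B.
Proof. by apply: (world_theory w).2. Qed.

Lemma unbox_theory (i : 'I_n) (w : world) : theory [set A | truths w (Box i A)].
Proof.
split=> [A LA|A B /= wAB wA].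
  by apply: (world_theory w).1; exact: normal_gen nL i A LA.
apply: world_mp wA; apply: world_mp wAB; apply: (world_theory w).1.
exact: normal_subst nL (fun p => if p == 0 then A else B) _ (normal_K nL i).
Qed.

(** The formulas boxed in [w] form a theory omitting [A]; any complete extension that still omits
    [A] is a successor of [w]. *)
Lemma canonical_succ {i w A} : ~ truths w (Box i A) ->
  exists2 u, canonical_rel i w u & ~ truths u A.
Proof.
move=> nwA; have [M cM [sM nMA]] := lindenbaum (unbox_theory i w) nwA.
by have [u uM] := world_of cM; exists u; rewrite /canonical_rel uM.
Qed.

Lemma canonical_truth (w : world) (A : form n) :
  ktruth canonical_rel canonical_val w A <-> truths w A.
Proof.
elim: A w => [p | | B IHB C IHC | i B IHB] w //=.
- by split=> //; have [] := svalP w.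
- have [_ w0 wN] := svalP w; split=> [H|wBC /IHB wB]; last first.
    by apply/IHC; exact: world_mp wBC wB.
  have [wB|wB] := wN B.
    have /IHB/H/IHC wC := wB.
    by apply: world_mp wC; apply: theory_taut (world_theory w) _; taut.
  by apply: world_mp wB; apply: theory_taut (world_theory w) _; taut.
- split=> [H|wB u wu]; last by apply/IHB; exact: wu.
  apply: contrapT => /canonical_succ [u wu nuB].
  by apply: nuB; apply/IHB; exact: H.
Qed.

Lemma canonical_complete {A} : ~ L A ->
  exists w : world, ~ ktruth canonical_rel canonical_val w A.
Proof.
move=> nLA.
have thL : theory L by split=> // B C; exact: normal_mp nL B C.
have [M cM [_ nMA]] := lindenbaum thL nLA.
by have [w wM] := world_of cM; exists w => /canonical_truth; rewrite wM.
Qed.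

Lemma canonical_refl (i : 'I_n) :
  L (Imp (Box i (Var 0)) (Var 0)) -> forall w, canonical_rel i w w.
Proof.
move=> LT w A wA; apply: world_mp wA; apply: (world_theory w).1.
exact: (normal_subst nL (fun _ => A) LT).
Qed.

Lemma canonical_trans (i : 'I_n) :
  L (Imp (Box i (Var 0)) (Box i (Box i (Var 0)))) ->
  forall w u t, canonical_rel i w u -> canonical_rel i u t -> canonical_rel i w t.
Proof.
move=> L4 w u t wu ut A wA; apply: ut; apply: wu.
apply: world_mp wA; apply: (world_theory w).1.
exact: (normal_subst nL (fun _ => A) L4).
Qed.

(** A world containing [Box i Bot] would contain [Dia i Bot] by D, against the generalized tautology
    [Neg Bot]. So [Box i Bot] fails, which provides a successor. *)
Lemma canonical_serial (i : 'I_n) :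
  L (Imp (Box i (Var 0)) (Dia i (Var 0))) -> forall w, exists u, canonical_rel i w u.
Proof.
move=> LD w; have [wBot|/canonical_succ [u wu _]] := pselect (truths w (Box i Bot)).
  exfalso; have [[Lw mpw] w0 _] := svalP w; apply: w0.
  apply: (mpw (Box i (Neg Bot))).
    apply: mpw wBot; apply: Lw.
    exact: (normal_subst nL (fun _ => Bot) LD).
  by apply: Lw; apply: (normal_gen nL); apply: (normal_taut nL); taut.
by exists u.
Qed.

End Canonical.

(** * Neighborhood frames of time-stamped sequences *)

(** The allowed number of letters in an extension: one always, none under T, two or more under 4. *)
Definition admissible (r t : bool) (m : nat) : bool :=
  [|| m == 1, r && (m == 0) | t && (1 < m)].

Section SequenceFrame.
Context (W : Type) (r t : bool).

Definition seq_tau (_ : 'I_1) (a : seq (nat * W)) : set (set (seq (nat * W))) :=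
  [set U | exists k, forall s,
     admissible r t (size s) -> all (fun p => k <= p.1) s -> U (a ++ s)].

Lemma all_late_leq (k l : nat) (s : seq (nat * W)) :
  k <= l -> all (fun p => l <= p.1) s -> all (fun p => k <= p.1) s.
Proof. by move=> kl; apply: sub_all => p; exact: leq_trans. Qed.

Lemma seq_tau_filter i a : Filter (seq_tau i a).
Proof.
split.
- by exists 0.
- move=> U V [k kU] [l lV]; exists (maxn k l) => s As late; split.
    by apply: kU => //; apply: all_late_leq late; exact: leq_maxl.
  by apply: lV => //; apply: all_late_leq late; exact: leq_maxr.
- by move=> U V UV [k kU]; exists k => s As late; apply: UV; exact: kU.
Qed.

Lemma seq_nonempty : [set: seq (nat * W)] !=set0.
Proof. by exists [::]. Qed.

Definition seq_frame : nframe 1 := NFrame seq_nonempty seq_tau_filter.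

Lemma seq_frame_TD (w0 : W) : valid seq_frame (axiomTD r).
Proof.
rewrite /axiomTD; case E: r => v a /=; last first.
  move=> [U [k kU] UA] [V [l lV] VN].
  (* The stamp [maxn k l] is late enough for both neighborhoods, so this one-letter extension lies
     in their intersection. *)
  pose s := [:: (maxn k l, w0)].
  apply: (VN (a ++ s)); first by apply: lV; rewrite //= leq_maxr.
  by apply: UA; apply: kU; rewrite //= leq_maxl.
move=> [U [k kU] UA]; rewrite -[a]cats0; apply: UA; apply: kU => //.
by rewrite /admissible E.
Qed.

Lemma admissibleD (m l : nat) :
  t -> admissible r t m -> admissible r t l -> admissible r t (m + l).
Proof.
rewrite /admissible => ->.
by case: m => [|[|m]]; case: l => [|[|l]]; rewrite ?addn0 ?addnS ?addSn //= ?orbT.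
Qed.

Lemma seq_frame_4 : t -> valid seq_frame axiom4.
Proof.
move=> tt v a /= [U [k kU] UA].
(* The same bound [k] serves twice, because two late admissible extensions concatenate to one. *)
exists [set b | seq_tau ord0 b U]; last by move=> b bU; exists U.
exists k => s As late; exists k => s' As' late'; rewrite -catA; apply: kU.
  by rewrite size_cat admissibleD.
by rewrite all_cat late.
Qed.

End SequenceFrame.

(** * Merging, runs and the transfer of truth *)

(** No sortedness is assumed: every letter of [u] loses against every letter of [s2], so [s2] is
    used up before [u] begins. *)
Lemma merge_catl (T : Type) (leT : rel T) (s1 s2 u : seq T) :
  allrel (fun x y => ~~ leT x y) u s2 ->
  merge leT (s1 ++ u) s2 = merge leT s1 s2 ++ u.
Proof.
elim: s1 s2 => [|x s1 IH1] /= s2.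
  elim: s2 => [|y s2 IH2] /=; first by case: u.
  rewrite allrel_consr => /andP[uy /IH2 <-].
  by case: u uy {IH2} => [|z u] //= /andP[/negPf ->].
elim: s2 => [|y s2 IH2] //= us; case: ifP => _; first by rewrite IH1.
by congr (_ :: _); apply: IH2; move: us; rewrite allrel_consr => /andP[].
Qed.

Lemma merge_catr (T : Type) (leT : rel T) (s1 s2 u : seq T) :
  allrel leT s1 u -> merge leT s1 (s2 ++ u) = merge leT s1 s2 ++ u.
Proof.
elim: s1 s2 => [|x s1 IH1] //= s2.
rewrite allrel_consl => /andP[xu su].
elim: s2 => [|y s2 IH2] /=; last first.
  by case: ifP => _; congr (_ :: _); [exact: (IH1 (y :: s2)) | exact: IH2].
case: u xu su {IH1} (IH1 [::]) => [|z u] /=; first by move=> *; rewrite cats0.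
move=> /andP[-> _] su -> //.
by case: (s1).
Qed.

Section Pullback.
Context (W : Type) (R : 'I_2 -> W -> W -> Prop) (v : nat -> W -> Prop).
Context (w0 : W) (r t : 'I_2 -> bool).
Hypothesis serialR : forall i w, exists u, R i w u.
Hypothesis reflR : forall i, r i -> forall w, R i w w.
Hypothesis transR : forall i, t i ->
  forall w u z, R i w u -> R i u z -> R i w z.

(* The letter [a] executed on side [i] means "move to [a]", or to some default
   successor when [a] is not accessible. *)
Definition step (w : W) (e : nat * 'I_2 * W) : W :=
  if `[< R e.1.2 w e.2 >] then e.2 else sval (cid (serialR e.1.2 w)).

Lemma stepR w e : R e.1.2 w (step w e).
Proof.
by rewrite /step; case: asboolP => // _; case: (cid _).
Qed.

(** The side must survive merging, since it selects the relation along which a letter is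
    executed. *)
Definition tag_side (i : 'I_2) (s : seq (nat * W)) : seq (nat * 'I_2 * W) :=
  [seq (p.1, i, p.2) | p <- s].

Definition earlier (e f : nat * 'I_2 * W) : bool := e.1.1 <= f.1.1.

Definition run (a b : seq (nat * W)) : W :=
  foldl step w0 (merge earlier (tag_side ord0 a) (tag_side ord_max b)).

Lemma exists_time_bound (s : seq (nat * W)) :
  exists k, all (fun p => p.1 < k) s.
Proof.
elim: s => [|p s [k sk]]; first by exists 0.
exists (maxn p.1.+1 k); rewrite /= leq_maxl /=.
by apply: sub_all sk => q qk; rewrite leq_max qk orbT.
Qed.

(** Ties in [earlier] favor the first factor, so the letters of [s] come last only if strictly later
    than those of [b]. *)
Lemma run_catl (a b s : seq (nat * W)) (k : nat) :
  all (fun p => p.1 < k) b -> all (fun p => k <= p.1) s ->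
  run (a ++ s) b = foldl step (run a b) (tag_side ord0 s).
Proof.
move=> bk ks; rewrite /run {1}/tag_side map_cat merge_catl ?foldl_cat //.
rewrite /tag_side allrel_mapl allrel_mapr /allrel; apply: sub_all ks => p kp.
by apply: sub_all bk => q qk; rewrite /earlier /= -ltnNge; exact: leq_trans kp.
Qed.

Lemma run_catr (a b s : seq (nat * W)) (k : nat) :
  all (fun p => p.1 < k) a -> all (fun p => k <= p.1) s ->
  run a (b ++ s) = foldl step (run a b) (tag_side ord_max s).
Proof.
move=> ak ks; rewrite /run {1}[tag_side _ (_ ++ _)]map_cat merge_catr ?foldl_cat //.
rewrite /tag_side allrel_mapl allrel_mapr /allrel; apply: sub_all ak => p pk.
by apply: sub_all ks => q kq; rewrite /earlier /=; exact: leq_trans (ltnW pk) kq.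
Qed.

(** No letter uses reflexivity, one letter is a single step, and longer words compose steps by
    transitivity. *)
Lemma foldl_stepR (i : 'I_2) (s : seq (nat * W)) (w : W) :
  admissible (r i) (t i) (size s) -> R i w (foldl step w (tag_side i s)).
Proof.
have trans_run p s' w' : t i -> R i w' (foldl step w' (tag_side i (p :: s'))).
  move=> ti; elim: s' p w' => [|q s' IH] p w'; first exact: (stepR w' (p.1, i, p.2)).
  by apply: (transR _ ti) (stepR w' (p.1, i, p.2)) _; exact: IH.
case: s => [|p [|q s]]; rewrite /admissible /=.
- by rewrite andbF orbF andbT => /reflR; apply.
- by move=> _; exact: (stepR w (p.1, i, p.2)).
- by rewrite andbF andbT /= => ti; exact: (trans_run p (q :: s)).
Qed.

Definition pullback_frame : nframe 2 :=
  nprod (seq_frame W (r ord0) (t ord0)) (seq_frame W (r ord_max) (t ord_max)).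

Lemma truth_pullback (A : form 2) (a b : seq (nat * W)) :
  @truth 2 pullback_frame (fun p => [set x | v p (run x.1 x.2)]) (a, b) A <->
  ktruth R v (run a b) A.
Proof.
elim: A a b => [p | | B IHB C IHC | i B IHB] a b //=.
  by split=> H /IHB/H/IHC.
have [->|->] : i = ord0 \/ i = ord_max.
  by case: i => -[|[|//]] ilt; [left | right]; exact: val_inj.
- rewrite /prod_tau /=; have [l bl] := exists_time_bound b; split.
    move=> [U [V [k kV] VU] UB] w aw.
    (* The stamp is at least [k], to stay in the given neighborhood, and at least [l], to be
       executed after [b]; the letter then leads exactly to the accessible world [w]. *)
    have late : all (fun p => l <= p.1) [:: (maxn k l, w)] by rewrite /= leq_maxr.
    have /IHB : @truth 2 pullback_frame (fun p => [set x | v p (run x.1 x.2)])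
        (a ++ [:: (maxn k l, w)], b) B.
      by apply/UB/VU; split=> //; apply: kV; rewrite //= leq_maxl.
    by rewrite (run_catl _ _ _ _ bl late) /= /step /=; case: asboolP.
  (* [V] is a neighborhood of [a]: extensions later than all of [b] prolong the run along
     [R ord0]. *)
  move=> H; pose V := [set c : seq (nat * W) | R ord0 (run a b) (run c b)].
  exists (V `*` [set b]); last by move=> [c d] [/= Vc ->]; apply/IHB/H.
  exists V => //; exists l => s As late /=.
  by rewrite /V /= (run_catl _ _ _ _ bl late); exact: foldl_stepR.
- rewrite /prod_tau /=; have [l al] := exists_time_bound a; split.
    move=> [U [V [k kV] VU] UB] w bw.
    have late : all (fun p => l <= p.1) [:: (maxn k l, w)] by rewrite /= leq_maxr.
    have /IHB : @truth 2 pullback_frame (fun p => [set x | v p (run x.1 x.2)])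
        (a, b ++ [:: (maxn k l, w)]) B.
      by apply/UB/VU; split=> //; apply: kV; rewrite //= leq_maxl.
    by rewrite (run_catr _ _ _ _ al late) /= /step /=; case: asboolP.
  move=> H; pose V := [set c : seq (nat * W) | R ord_max (run a b) (run a c)].
  exists ([set a] `*` V); last by move=> [c d] [/= -> Vd]; apply/IHB/H.
  exists V => //; exists l => s As late /=.
  by rewrite /V /= (run_catr _ _ _ _ al late); exact: foldl_stepR.
Qed.

End Pullback.

(** * Completeness: refutation on a product of sequence frames *)

Lemma nproduct_sub_fusion (L1 L2 : set (form 1))
  (hL1 : [set logicS4; logicD4; logicD; logicT] L1)
  (hL2 : [set logicS4; logicD4; logicD; logicT] L2) :
  nproduct L1 L2 `<=` fusion L1 L2.
Proof.
move=> A pA; apply: contrapT => nfA.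
have [r1 [t1 [TD1 F1 nV1]]] := logic_cases hL1.
have [r2 [t2 [TD2 F2 nV2]]] := logic_cases hL2.
pose r (i : 'I_2) := if i == ord0 then r1 else r2.
pose t (i : 'I_2) := if i == ord0 then t1 else t2.
have nL : normal_logic (fusion L1 L2) by exact: smallest_normal_logic.
have sub1 B : L1 B -> fusion L1 L2 (rebox ord0 B).
  move=> L1B M [_]; apply; left=> M' [_]; apply; right.
  by exists B.
have sub2 B : L2 B -> fusion L1 L2 (rebox ord_max B).
  by move=> L2B M [_]; apply; right; exists B.
have ordE (i : 'I_2) : i = ord0 \/ i = ord_max.
  by case: i => -[|[|//]] ilt; [left | right]; exact: val_inj.
have LTD i : fusion L1 L2 (rebox i (axiomTD (r i))).
  by have [->|->] := ordE i; [exact: sub1 TD1 | exact: sub2 TD2].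
have L4 i : t i -> fusion L1 L2 (rebox i axiom4).
  by have [->|->] := ordE i; [move=> /F1/sub1 | move=> /F2/sub2].
have [w0 nw0] := canonical_complete _ nL nfA.
have reflR i : r i -> forall w, canonical_rel (fusion L1 L2) i w w.
  by move=> ri; apply: (canonical_refl _ nL); have := LTD i; rewrite ri.
have serialR i w : exists u, canonical_rel (fusion L1 L2) i w u.
  (* Seriality comes from reflexivity in the T case and from the axiom D otherwise. *)
  case E: (r i); first by exists w; exact: reflR.
  by apply: (canonical_serial _ nL); have := LTD i; rewrite E.
have transR i (ti : t i) := canonical_trans _ nL i (L4 i ti).
apply: nw0.
(* The run of two empty sequences ends at [w0], the canonical world refuting [A]. *)
apply: (truth_pullback _ _ (canonical_val _) w0 r t serialR reflR transR
  A [::] [::]).1.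
apply: pA; exists (seq_frame (world (fusion L1 L2)) r1 t1),
  (seq_frame (world (fusion L1 L2)) r2 t2); split=> //.
- by apply: nV1 => [|t1T]; [exact: seq_frame_TD | exact: seq_frame_4].
- by apply: nV2 => [|t2T]; [exact: seq_frame_TD | exact: seq_frame_4].
Qed.

Theorem theorem6p1 (L1 L2 : set (form 1))
  (hL1 : [set logicS4; logicD4; logicD; logicT] L1)
  (hL2 : [set logicS4; logicD4; logicD; logicT] L2) :
  nproduct L1 L2 = fusion L1 L2.
Proof.
apply/seteqP; split; first exact: nproduct_sub_fusion.
exact: fusion_sub_nproduct.
Qed.
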